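(* Let $(H,R_{\mathsf z}R_{\boldsymbol\alpha})$ be a Nenciu type Hopf algebra generated by grouplike $K_a$ and nilpotent $X_k$, $Z_l^\pm$ generators for $a=1,\dots,s$, $k=1,\dots,t_1$ and $l=1,\dots,t_2$, satisfying the assumptions in the context. Then the Müger centre $\mathcal Z_{(2)}(H\text{-mod})$ is a non-semisimple subcategory of $H\text{-mod}$.
   Context: Nenciu type Hopf algebra: let $s,t\ge1$, $\mathbf m=(m_1,\dots,m_s)\in\mathbb Z_{>0}^s$, $\xi_a=\exp(2\pi i/m_a)$, $\mathbb Z_{\mathbf m}=\prod_a\mathbb Z/m_a\mathbb Z$. For tuples, $\mathbf v\cdot\mathbf w$ is the entrywise product and $\boldsymbol\xi^{\mathbf v}=\prod_a\xi_a^{v_a}$, $\mathbf K^{\mathbf v}=\prod_aK_a^{v_a}$. Let $\mathsf d,\mathsf u$ be integer $t\times s$ matrices with rows $\mathsf d_k,\mathsf u_k$ satisfying $\boldsymbol\xi^{\mathsf d_k\cdot\mathsf u_l}\boldsymbol\xi^{\mathsf d_l\cdot\mathsf u_k}=1$ and $\boldsymbol\xi^{\mathsf d_k\cdot\mathsf u_k}=-1$. $H(\mathbf m,t,\mathsf d,\mathsf u)$ is the Hopf algebra over $\mathbb C$ generated by grouplike $K_1,\dots,K_s$ and nilpotent $X_1,\dots,X_t$ with relations $K_a^{m_a}=1$, $K_aK_b=K_bK_a$, $K_aX_k=\xi_a^{d_{ka}}X_kK_a$, $X_k^2=0$, $X_lX_k=\boldsymbol\xi^{\mathsf d_k\cdot\mathsf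 u_l}X_kX_l$, and $\Delta(X_k)=1\otimes X_k+X_k\otimes\mathbf K^{\mathsf u_k}$, $\epsilon(X_k)=0$, $S(X_k)=-X_k\mathbf K^{-\mathsf u_k}$. Assumptions: the nilpotent generators consist of a (possibly empty) set of generators denoted $X_k$, $k=1,\dots,t_1$, and generators denoted $Z_l^\pm$, $l=1,\dots,t_2$, where $Z_l^+$ and $Z_l^-$ are of opposite type (their rows in $\mathsf d$ and in $\mathsf u$ are negatives of each other modulo $m_a$ in column $a$), all $Z_l^\pm$ pairwise anticommute, and the $X_k$ anticommute with all $Z_l^\pm$ and do not participate in $R_{\boldsymbol\alpha}$. $L_l=\mathbf K^{\mathsf u_l}$ is the grouplike element attached to $Z_l^+$ in its coproduct. $R=R_{\mathsf z}R_{\boldsymbol\alpha}$ is an R-matrix with $R_{\mathsf z}=\frac1{\prod_am_a}\sum_{\mathbf v,\mathbf w\in\mathbb Z_{\mathbf m}}\boldsymbol\xi^{-\mathbf v\cdot\mathbf w}\mathbf K^{\mathbf w}\otimes\mathbf K^{\mathbf v\mathsf z}$ for an integer $s\times s$ matrix $\mathsf z$, satisfying $R_{\mathsf z}R_{\mathsf z,21}=1\otimes1$, and $R_{\boldsymbol\alpha}=\exp\big(\sum_{l=1}^{t_2}\alpha_l(Z_l^+\otimes L_lZ_l^--Z_l^-\otimes L_lZ_l^+)\big)$, $\alpha_l\in\mathbb C$; its monodromy matrix is $M=R_{21}R=\exp\big(2\sum_{l}\alpha_l(Z_l^+\otimes L_lZ_l^--Z_l^-\otimes L_lZ_l^+)\big)$.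 $H$-mod is the category of finite-dimensional left $H$-modules with braiding $v\otimes w\mapsto R''w\otimes R'v$. Its Müger centre $\mathcal Z_{(2)}(H\text{-mod})$ is the full subcategory of transparent objects: those $V$ for which the double braiding on $V\otimes W$ is the identity for every $W\in H$-mod.
   Formalization: The formal theorem additionally assumes that t_1 ≥ 1 or some α_l = 0; if there are no X_k and all α_l are nonzero, transparent modules have all Z_l^± acting by zero, so the Müger centre is semisimple and the claim is false. *)

(* Defs.v *)
From HB Require Import structures.
From mathcomp Require Import all_boot all_order all_algebra all_field.
From mathcomp Require Import reals trigo.
From mathcomp Require Import complex.
Set Implicit Arguments.
Unset Strict Implicit.
Unset Printing Implicit Defensive.

Import Order.TTheory GRing.Theory Num.Theory.
Local Open Scope ring_scope.

(* The tensor product of finite-dimensional spaces is represented by          *)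
(* coordinate matrices with respect to the bases vbasis fullv; textend below  *)
(* is its universal property (textendE, textend_linear, tens_span).           *)
Section TensorSpace.
Variable F : fieldType.

Definition tens (U V : vectType F) : Type := 'M[F]_(\dim {:U}, \dim {:V}).
HB.instance Definition _ (U V : vectType F) := Vector.on (tens U V).

Definition tpure (U V : vectType F) (u : U) (v : V) : tens U V :=
  \matrix_(i, j) (coord (vbasis {:U}) i u * coord (vbasis {:V}) j v).

Definition textend (U V : vectType F) (W : lmodType F) (f : U -> V -> W)
    (x : tens U V) : W :=
  \sum_i \sum_j x i j *: f (vbasis {:U})`_i (vbasis {:V})`_j.

Definition bilin (U V W : lmodType F) (f : U -> V -> W) :=
  (forall v, linear (f^~ v)) /\ (forall u, linear (f u)).

Lemma textend_linear (U V : vectType F) (W : lmodType F) (f : U -> V -> W) :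
  linear (textend f).
Proof.
move=> a x y; rewrite /textend scaler_sumr -big_split; apply: eq_bigr => i _.
rewrite scaler_sumr -big_split; apply: eq_bigr => j _ /=.
by rewrite !mxE scalerDl scalerA.
Qed.

HB.instance Definition _ (U V : vectType F) (W : lmodType F)
    (f : U -> V -> W) :=
  GRing.isLinear.Build F (tens U V) W _ (textend f) (textend_linear f).

Lemma eq_textend (U V : vectType F) (W : lmodType F) (f g : U -> V -> W) x :
  (forall u v, f u v = g u v) -> textend f x = textend g x.
Proof. by move=> fg; apply: eq_bigr => i _; apply: eq_bigr => j _; rewrite fg. Qed.

Lemma textend_lincomb (U V : vectType F) (W : lmodType F) (f g : U -> V -> W)
    (c : F) (x : tens U V) :
  textend (fun u v => c *: f u v + g u v) x = c *: textend f x + textend g x.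
Proof.
rewrite /textend scaler_sumr -big_split; apply: eq_bigr => i _.
rewrite scaler_sumr -big_split; apply: eq_bigr => j _ /=.
by rewrite scalerDr !scalerA [c * _]mulrC.
Qed.

Lemma bilin_sum (U V W : lmodType F) (f : U -> V -> W) (I J : finType)
    (a : I -> F) (u : I -> U) (b : J -> F) (v : J -> V) : bilin f ->
  f (\sum_i a i *: u i) (\sum_j b j *: v j) =
  \sum_i \sum_j (a i * b j) *: f (u i) (v j).
Proof.
case=> fl fr.
have sumf (A : lmodType F) (g : A -> W) (K : finType) (c : K -> F) (w : K -> A) :
    linear g -> g (\sum_k c k *: w k) = \sum_k c k *: g (w k).
  move=> lg.
  have g0 : g 0 = 0.
    by have := lg (-1) 0 0; rewrite scaler0 addr0 scaleN1r addNr.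
  elim/big_rec2: _ => // k x y _ <-; exact: lg.
rewrite (sumf _ (f^~ _)) //; apply: eq_bigr => i _.
by rewrite sumf // scaler_sumr; apply: eq_bigr => j _; rewrite scalerA.
Qed.

Lemma textendE (U V : vectType F) (W : lmodType F) (f : U -> V -> W) u v :
  bilin f -> textend f (tpure u v) = f u v.
Proof.
move=> bf; rewrite /textend {2}(coord_vbasis (memvf u)).
rewrite {2}(coord_vbasis (memvf v)) bilin_sum //.
by apply: eq_bigr => i _; apply: eq_bigr => j _; rewrite mxE.
Qed.

Lemma tpure_bilin (U V : vectType F) : bilin (@tpure U V).
Proof.
split=> [v a x y|u a x y]; apply/matrixP=> i j; rewrite !mxE linearP.
  by rewrite mulrDl mulrA.
by rewrite mulrDr mulrCA.
Qed.

Lemma tpure_basis (U V : vectType F) (i : 'I_(\dim {:U})) (j : 'I_(\dim {:V})) :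
  tpure (vbasis {:U})`_i (vbasis {:V})`_j = delta_mx i j.
Proof.
apply/matrixP=> k l; rewrite !mxE !coord_free ?(basis_free (vbasisP _)) //.
by rewrite -natrM mulnb [i == k]eq_sym [j == l]eq_sym.
Qed.

Lemma tens_span (U V : vectType F) (x : tens U V) : textend (@tpure U V) x = x.
Proof.
rewrite {2}[x]matrix_sum_delta.
by apply: eq_bigr => i _; apply: eq_bigr => j _; rewrite tpure_basis.
Qed.

Definition tmap (U V U' V' : vectType F) (f : U -> U') (g : V -> V') :
  tens U V -> tens U' V' := textend (fun u v => tpure (f u) (g v)).

Definition tflip (U V : vectType F) : tens U V -> tens V U :=
  textend (fun u v => tpure v u).

End TensorSpace.

Notation "u ^⊗ v" := (tpure u v) (at level 40, left associativity).

Section TensorAlgebra.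
Variables (F : fieldType) (A B : falgType F).
Implicit Types x y z : tens A B.

Definition tmul x y : tens A B :=
  textend (fun a b => textend (fun a' b' => (a * a') ^⊗ (b * b')) y) x.

Lemma tmul_linearl y : linear (tmul^~ y).
Proof. exact: textend_linear. Qed.

Lemma tmul_linearr x : linear (tmul x).
Proof.
move=> c y z; rewrite /tmul -textend_lincomb.
by apply: eq_textend => a b; rewrite textend_linear.
Qed.

Lemma tmulE (a a' : A) (b b' : B) :
  tmul (a ^⊗ b) (a' ^⊗ b') = (a * a') ^⊗ (b * b').
Proof.
have bl (c : A) (d : B) : bilin (fun a' b' => (c * a') ^⊗ (d * b')).
  have [l r] := @tpure_bilin F A B.
  by split=> [v|u] k x y; rewrite mulrDr -scalerAr ?l ?r.
have [l r] := @tpure_bilin F A B.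
rewrite /tmul textendE ?textendE //; split=> [v|u] k x y.
  rewrite -textend_lincomb; apply: eq_textend => c d.
  by rewrite mulrDl -scalerAl l.
rewrite -textend_lincomb; apply: eq_textend => c d.
by rewrite mulrDl -scalerAl r.
Qed.

Lemma tens_ind (P : tens A B -> Prop) :
  (forall c x y, P x -> P y -> P (c *: x + y)) ->
  (forall a b, P (a ^⊗ b)) -> forall x, P x.
Proof.
move=> Plin Pp x; have P0 : P 0.
  by have := Plin (-1) _ _ (Pp 0 0) (Pp 0 0); rewrite scaleN1r addNr.
have PD y z : P y -> P z -> P (y + z).
  by move=> Py Pz; rewrite -[y]scale1r; apply: Plin.
rewrite -[x]tens_span; apply: (big_ind P) => // i _; apply: (big_ind P) => // j _.
by rewrite -[_ *: _]addr0; apply: Plin.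
Qed.

Lemma tmulA : associative tmul.
Proof.
move=> x y z.
elim/tens_ind: x => [c x x' IH IH'|a b]; first by rewrite !tmul_linearl IH IH'.
elim/tens_ind: y => [c y y' IH IH'|a' b'].
  by rewrite tmul_linearl !tmul_linearr tmul_linearl IH IH'.
elim/tens_ind: z => [c z z' IH IH'|a'' b'']; first by rewrite !tmul_linearr IH IH'.
by rewrite !tmulE !mulrA.
Qed.

Lemma tmul1x : left_id (1 ^⊗ 1) tmul.
Proof.
move=> x; elim/tens_ind: x => [c x y IH IH'|a b].
  by rewrite tmul_linearr IH IH'.
by rewrite tmulE !mul1r.
Qed.

Lemma tmulx1 : right_id (1 ^⊗ 1) tmul.
Proof.
move=> x; elim/tens_ind: x => [c x y IH IH'|a b].
  by rewrite tmul_linearl IH IH'.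
by rewrite tmulE !mulr1.
Qed.

Lemma tmulDl : left_distributive tmul +%R.
Proof. by move=> x y z; rewrite -[x]scale1r tmul_linearl !scale1r. Qed.

Lemma tmulDr : right_distributive tmul +%R.
Proof. by move=> x y z; rewrite -[y]scale1r tmul_linearr !scale1r. Qed.

Lemma tone_neq0 : (1 ^⊗ 1 : tens A B) != 0.
Proof.
apply/eqP => e0.
have nz (D : falgType F) : exists i, coord (vbasis {:D}) i 1 != 0.
  apply/existsP; rewrite -[[exists _, _]]negbK negb_exists; apply/negP.
  move/forallP=> c0; have := oner_neq0 D.
  rewrite (coord_vbasis (memvf (1 : D))) big1 ?eqxx // => i _.
  by move/(_ i): c0; rewrite negbK => /eqP ->; rewrite scale0r.
have [i ni] := nz A; have [j nj] := nz B.
have := congr1 (fun M : 'M_(_, _) => M i j) e0; rewrite !mxE => /eqP.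
by rewrite mulf_eq0 (negbTE ni) (negbTE nj).
Qed.

HB.instance Definition _ := GRing.Zmodule_isNzRing.Build (tens A B)
  tmulA tmul1x tmulx1 tmulDl tmulDr tone_neq0.

Lemma tscaleAl (c : F) x y : c *: (x * y) = (c *: x) * y.
Proof.
have y0 : tmul 0 y = 0 := mul0r y.
by have := tmul_linearl y c x 0; rewrite y0 !addr0 => /esym.
Qed.

Lemma tscaleAr (c : F) x y : c *: (x * y) = x * (c *: y).
Proof.
have x0 : tmul x 0 = 0 := mulr0 x.
by have := tmul_linearr x c y 0; rewrite x0 !addr0 => /esym.
Qed.

HB.instance Definition _ :=
  GRing.Lmodule_isLalgebra.Build F (tens A B) tscaleAl.
HB.instance Definition _ :=
  GRing.Lalgebra_isAlgebra.Build F (tens A B) tscaleAr.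
HB.instance Definition _ := Algebra_isFalgebra.Build F (tens A B).

End TensorAlgebra.

(* For nilpotent x in a finite-dimensional algebra, x ^+ n = 0 as soon as n   *)
(* reaches the dimension, so this is the full exponential series.             *)
Definition nilexp (F : fieldType) (A : falgType F) (x : A) : A :=
  \sum_(n < (\dim {:A}).+1) (n`!%:R)^-1 *: x ^+ n.

Section Hopf.
Variable F : fieldType.

Definition tassoc (U V W : vectType F) :
    tens U (tens V W) -> tens (tens U V) W :=
  textend (fun u => textend (fun v w => (u ^⊗ v) ^⊗ w)).

Record hopfStruct (A : falgType F) := HopfStruct {
  comul : {lrmorphism A -> tens A A};
  counit : {lrmorphism A -> F^o};
  antipode : {linear A -> A};
  comulA : forall x, tmap comul id (comul x) = tassoc (tmap id comul (comul x));
  counitl : forall x, textend (fun a b => (counit a : F) *: b) (comul x) = x;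
  counitr : forall x, textend (fun a b => (counit b : F) *: a) (comul x) = x;
  antipodel : forall x,
    textend (fun a b => antipode a * b) (comul x) = (counit x : F)%:A;
  antipoder : forall x,
    textend (fun a b => a * antipode b) (comul x) = (counit x : F)%:A
}.

Definition grouplike (A : falgType F) (hA : hopfStruct A) (g : A) :=
  comul hA g = g ^⊗ g /\ counit hA g = 1.

Definition leg12 (A : falgType F) : tens A A -> tens (tens A A) A :=
  textend (fun a b => (a ^⊗ b) ^⊗ 1).
Definition leg13 (A : falgType F) : tens A A -> tens (tens A A) A :=
  textend (fun a b => (a ^⊗ 1) ^⊗ b).
Definition leg23 (A : falgType F) : tens A A -> tens (tens A A) A :=
  textend (fun a b => (1 ^⊗ a) ^⊗ b).

Record is_Rmatrix (A : falgType F) (hA : hopfStruct A) (r : tens A A) : Prop := {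
  Rmatrix_unit : r \is a GRing.unit;
  Rmatrix_comul : forall x, r * comul hA x = tflip (comul hA x) * r;
  Rmatrix_hexl : tmap (comul hA) id r = leg13 r * leg23 r;
  Rmatrix_hexr : tassoc (tmap id (comul hA) r) = leg13 r * leg12 r
}.

End Hopf.

Section Modules.
Variables (F : fieldType) (A : falgType F).

Record fdmod := FdMod {
  fdmod_sort :> vectType F;
  act : A -> 'End(fdmod_sort);
  act_linear : linear act;
  act1 : act 1 = \1%VF;
  actM : forall a b, act (a * b) = (act a \o act b)%VF
}.

Definition modhom (V W : fdmod) (f : 'Hom(V, W)) :=
  forall a v, f (act V a v) = act W a (f v).

Definition tact (V W : fdmod) (r : tens A A) (x : tens V W) : tens V W :=
  textend (fun a b => tmap (act V a) (act W b) x) r.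

Definition braiding (r : tens A A) (V W : fdmod) (x : tens V W) : tens W V :=
  tflip (tact r x).

(* A full subcategory of the category of modules is given by its objects.     *)
Definition fullsubcat := fdmod -> Prop.

Definition mueger_centre (r : tens A A) : fullsubcat := fun V =>
  forall (W : fdmod) (x : tens V W), braiding r (braiding r x) = x.

Definition simple_obj (C : fullsubcat) (S : fdmod) :=
  [/\ C S, ({:S} != 0)%VS &
    forall (T : fdmod) (f : 'Hom(T, S)), C T -> modhom f ->
      lker f = 0%VS -> limg f = 0%VS \/ limg f = fullv].

Definition semisimple_subcat (C : fullsubcat) :=
  forall V : fdmod, C V ->
  exists (n : nat) (S : 'I_n -> fdmod) (j : forall i, 'Hom(S i, V)),
    [/\ forall i, simple_obj C (S i),
        forall i, modhom (j i) /\ lker (j i) = 0%VS,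
        directv (\sum_i limg (j i))%VS &
        (\sum_i limg (j i))%VS = fullv].

End Modules.

Section Nenciu.
Variable R : realType.
Local Notation C := R[i].

Definition xi (n : nat) : C :=
  Complex (cos (2 * pi / n%:R)) (sin (2 * pi / n%:R)).

Section Tuples.
Variables (s : nat) (m : 'I_s -> nat).

Definition entrymul (v w : 'rV[int]_s) : 'rV[int]_s := \row_a (v 0 a * w 0 a).

Definition xipow (v : 'rV[int]_s) : C := \prod_a xi (m a) ^ (v 0 a).

Definition Kpow (A : falgType C) (K : 'I_s -> A) (v : 'rV[int]_s) : A :=
  \prod_a K a ^ (v 0 a).

Record nenciu_datum (t : nat) (d u : 'M[int]_(t, s)) : Prop := {
  nenciu_sgt0 : (0 < s)%N;
  nenciu_tgt0 : (0 < t)%N;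
  nenciu_mgt0 : forall a, (0 < m a)%N;
  nenciu_sym : forall k l,
    xipow (entrymul (row k d) (row l u)) * xipow (entrymul (row l d) (row k u))
    = 1;
  nenciu_diag : forall k, xipow (entrymul (row k d) (row k u)) = -1
}.

Record nenciu_relations (t : nat) (d u : 'M[int]_(t, s)) (B : algType C)
    (K : 'I_s -> B) (X : 'I_t -> B) : Prop := {
  nenciu_KX1 : forall a, K a ^+ m a = 1;
  nenciu_KK : forall a b, K a * K b = K b * K a;
  nenciu_KX : forall a k, K a * X k = xi (m a) ^ (d k a) *: (X k * K a);
  nenciu_X2 : forall k, X k ^+ 2 = 0;
  nenciu_XX : forall k l,
    X l * X k = xipow (entrymul (row k d) (row l u)) *: (X k * X l)
}.

(* nenciu_ex and nenciu_uniq say that H is the algebra presented by the       *)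
(* generators K, X and the relations above. The finite dimension built into   *)
(* falgType is no restriction: the ordered monomials K^v X_S span that algebra. *)
Record is_nenciu (t : nat) (d u : 'M[int]_(t, s)) (H : falgType C)
    (hH : hopfStruct H) (K : 'I_s -> H) (X : 'I_t -> H) : Prop := {
  nenciu_rel : nenciu_relations d u K X;
  nenciu_ex : forall (B : algType C) (K' : 'I_s -> B) (X' : 'I_t -> B),
    nenciu_relations d u K' X' ->
    exists f : {lrmorphism H -> B},
      (forall a, f (K a) = K' a) /\ (forall k, f (X k) = X' k);
  nenciu_uniq : forall (B : algType C) (f g : {lrmorphism H -> B}),
    (forall a, f (K a) = g (K a)) -> (forall k, f (X k) = g (X k)) -> f =1 g;
  nenciu_grouplike : forall a, grouplike hH (K a);
  nenciu_comul : forall k,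
    comul hH (X k) = 1 ^⊗ X k + X k ^⊗ Kpow K (row k u);
  nenciu_counit : forall k, counit hH (X k) = 0;
  nenciu_antipode : forall k, antipode hH (X k) = - X k * Kpow K (- row k u)
}.

(* v and w run through the representatives 0, ..., m_a - 1 of Z/m_a. The      *)
(* independence of K^(vz) from this choice is part of is_Rmatrix: it follows  *)
(* from the first hexagon identity.                                           *)
Definition Rz (z : 'M[int]_s) (H : falgType C) (K : 'I_s -> H) : tens H H :=
  let rep (v : {dffun forall a : 'I_s, 'I_(m a)}) : 'rV[int]_s :=
    \row_a (v a : nat)%:Z in
  (\prod_a (m a)%:R)^-1 *:
    \sum_v \sum_w xipow (- entrymul (rep v) (rep w)) *:
      (Kpow K (rep w) ^⊗ Kpow K (rep v *m z)).

(* The t1 + 2 t2 nilpotent generators are listed as X_1, ..., X_t1,           *)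
(* Z^+_1, ..., Z^+_t2, Z^-_1, ..., Z^-_t2.                                    *)
Section Split.
Variables t1 t2 : nat.

Definition idxX (k : 'I_t1) : 'I_(t1 + (t2 + t2)) := lshift _ k.
Definition idxZp (l : 'I_t2) : 'I_(t1 + (t2 + t2)) := rshift _ (lshift _ l).
Definition idxZm (l : 'I_t2) : 'I_(t1 + (t2 + t2)) := rshift _ (rshift _ l).

Definition opposite_type (d u : 'M[int]_(t1 + (t2 + t2), s)) :=
  forall l a, (d (idxZm l) a = - d (idxZp l) a %[mod m a])%Z /\
              (u (idxZm l) a = - u (idxZp l) a %[mod m a])%Z.

(* Distinct generators anticommute when one of them is some Z^+_l or Z^-_l.   *)
Definition Z_anticommute (H : falgType C) (X : 'I_(t1 + (t2 + t2)) -> H) :=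
  forall (i : 'I_(t1 + (t2 + t2))) (j : 'I_(t2 + t2)),
    i != rshift t1 j -> X i * X (rshift t1 j) = - (X (rshift t1 j) * X i).

Definition Ralpha (alpha : 'I_t2 -> C) (u : 'M[int]_(t1 + (t2 + t2), s))
    (H : falgType C) (K : 'I_s -> H) (X : 'I_(t1 + (t2 + t2)) -> H) :
    tens H H :=
  nilexp (\sum_l alpha l *:
    let L := Kpow K (row (idxZp l) u) in
    let Zp := X (idxZp l) in
    let Zm := X (idxZm l) in
    Zp ^⊗ (L * Zm) - Zm ^⊗ (L * Zp)).

End Split.
End Tuples.
End Nenciu.

(* Main.v *)
(* Pick a nilpotent generator X_i that R_alpha does not see: some X_k, or some
   Z_l^+ with alpha_l = 0.  Let V be the two-dimensional module on which
   K_a = diag(1, xi_a^(d_ia)), X_i = E_21 and every other nilpotent generator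
   vanishes.  Each summand in the exponent of R_alpha annihilates V (x) W and
   W (x) V, so on these only R_z acts, and R_z R_z,21 = 1 makes V transparent;
   the same holds for the line X_i V.  A simple summand of V not killed by X_i
   contains this line properly, contradicting its simplicity. *)
From HB Require Import structures.
Require Import Defs.
From mathcomp Require Import all_boot all_order all_algebra all_field.
From mathcomp Require Import reals trigo.
From mathcomp Require Import complex.
Set Implicit Arguments.
Unset Strict Implicit.
Unset Printing Implicit Defensive.

Import Order.TTheory GRing.Theory Num.Theory.
Local Open Scope ring_scope.

(** * Calculus with pure tensors *)

Lemma tpure0l (F : fieldType) (U V : vectType F) (v : V) : (0 : U) ^⊗ v = 0.
Proof. by apply/matrixP=> i j; rewrite !mxE linear0 mul0r. Qed.

Lemma tpure0r (F : fieldType) (U V : vectType F) (u : U) : u ^⊗ (0 : V) = 0.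
Proof. by apply/matrixP=> i j; rewrite !mxE linear0 mulr0. Qed.

Lemma linear_textend (F : fieldType) (U V : vectType F) (W : lmodType F)
    (h : tens U V -> W) (x : tens U V) :
  linear h -> h x = textend (fun u v => h (u ^⊗ v)) x.
Proof.
move=> lh; pose hL := GRing.isLinear.Build F (tens U V) W _ h lh.
pose h' : {linear tens U V -> W} := HB.pack h hL.
rewrite -[h]/(h' : _ -> _) -{1}[x]tens_span /textend linear_sum.
apply: eq_bigr => i _; rewrite linear_sum; apply: eq_bigr => j _.
by rewrite linearZ.
Qed.

(** Pure tensors span; identities of linear maps below are reduced to them this way. *)
Lemma tens_eq_linear (F : fieldType) (U V : vectType F) (W : lmodType F)
    (g h : tens U V -> W) :
  linear g -> linear h -> (forall u v, g (u ^⊗ v) = h (u ^⊗ v)) -> g =1 h.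
Proof.
move=> lg lh gh x; rewrite (linear_textend x lg).
by rewrite (linear_textend x lh); apply: eq_textend.
Qed.

Lemma tmapE (F : fieldType) (U V U' V' : vectType F)
    (f : {linear U -> U'}) (g : {linear V -> V'}) u v :
  tmap f g (u ^⊗ v) = f u ^⊗ g v.
Proof.
have [l r] := @tpure_bilin F U' V'; rewrite /tmap textendE //.
by split=> w a x y; rewrite linearP ?l ?r.
Qed.

Lemma tflipE (F : fieldType) (U V : vectType F) (u : U) (v : V) :
  tflip (u ^⊗ v) = v ^⊗ u.
Proof.
have [l r] := @tpure_bilin F V U; by rewrite /tflip textendE.
Qed.

Lemma tflip_linear (F : fieldType) (U V : vectType F) : linear (@tflip F U V).
Proof. exact: textend_linear. Qed.

Lemma tflipK (F : fieldType) (U V : vectType F) :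
  cancel (@tflip F U V) (@tflip F V U).
Proof.
apply: tens_eq_linear => [a x y|a x y //|u v]; last by rewrite !tflipE.
by rewrite !tflip_linear.
Qed.

(** * Action of [tens A A] on tensor products of modules, and transparency *)

Section TensorAction.
Variables (F : fieldType) (A : falgType F).
Implicit Types (V W : fdmod A) (r : tens A A).

Lemma actP V c a b (v : V) : act V (c *: a + b) v = c *: act V a v + act V b v.
Proof. by rewrite act_linear !lfunE /= lfunE. Qed.

Lemma act0 V (v : V) : act V 0 v = 0.
Proof. by have := actP (-1) 0 0 v; rewrite scaler0 addr0 scaleN1r addNr. Qed.

Lemma tact_linearl V W (x : tens V W) : linear (fun r => tact r x).
Proof. exact: textend_linear. Qed.

Lemma tact_linearr V W r : linear (@tact F A V W r).
Proof.
move=> c x y; rewrite /tact -textend_lincomb; apply: eq_textend => a b.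
by rewrite /tmap textend_linear.
Qed.

Lemma tactE V W (x : tens V W) (a b : A) :
  tact (a ^⊗ b) x = tmap (act V a) (act W b) x.
Proof.
have [l r] := @tpure_bilin F V W.
rewrite /tact textendE //; split=> [b' | a'] c e f; rewrite /tmap -textend_lincomb;
  by apply: eq_textend => u v; rewrite actP ?l ?r.
Qed.

Lemma tact_pure V W (a b : A) (v : V) (w : W) :
  tact (a ^⊗ b) (v ^⊗ w) = act V a v ^⊗ act W b w.
Proof. by rewrite tactE tmapE. Qed.

Lemma tact1 V W (x : tens V W) : tact 1 x = x.
Proof.
move: x; apply: tens_eq_linear => [|//|u v]; first exact: tact_linearr.
by rewrite tact_pure !act1 !lfunE.
Qed.

Lemma tactM V W r r' (x : tens V W) : tact (r * r') x = tact r (tact r' x).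
Proof.
move: x; apply: tens_eq_linear => [|c x y|u v]; first exact: tact_linearr.
  by rewrite !tact_linearr.
elim/tens_ind: r => [c r1 r2 IH1 IH2|a b].
  by rewrite mulrDl -scalerAl !tact_linearl IH1 IH2.
elim/tens_ind: r' => [c r1 r2 IH1 IH2|a' b'].
  by rewrite mulrDr -scalerAr !tact_linearl IH1 IH2 tact_linearr.
by rewrite [_ * _]tmulE !tact_pure !actM !lfunE.
Qed.

Lemma tact_flip V W r (x : tens V W) :
  tact r (tflip x) = tflip (tact (tflip r) x).
Proof.
move: x; apply: tens_eq_linear => [c x y|c x y|u v].
- by rewrite tflip_linear tact_linearr.
- by rewrite tact_linearr tflip_linear.
elim/tens_ind: r => [c r1 r2 IH1 IH2|a b].
  rewrite tact_linearl IH1 IH2 tflip_linear.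
  by rewrite tact_linearl tflip_linear.
by rewrite !tflipE !tact_pure tflipE.
Qed.

Lemma tact_eq0 V W (a b : A) (x : tens V W) :
  (forall v, act V a v = 0) \/ (forall w, act W b w = 0) -> tact (a ^⊗ b) x = 0.
Proof.
move=> ab0; move: x; apply: tens_eq_linear => [|c x y|v w].
- exact: tact_linearr.
- by rewrite scaler0 addr0.
by rewrite tact_pure; case: ab0 => ->; rewrite ?tpure0l ?tpure0r.
Qed.

(** Every power of [n] of positive degree acts through [n], so only the constant term of the
    exponential survives. *)
Lemma tact_nilexp V W (n : tens A A) (x : tens V W) :
  (forall y : tens V W, tact n y = 0) -> tact (nilexp n) x = x.
Proof.
move=> n0; rewrite /tact linear_sum big_ord_recl big1 => [|k _].
  by rewrite addr0 linearZ /= fact0 invr1 scale1r expr0; apply: tact1.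
by rewrite linearZ /= -[textend _ _]/(tact _ _) exprS tactM n0 scaler0.
Qed.

(** The first braiding acts on [tens V W], the second on [tens W V], so the exponent has to vanish
    on both. What remains, once the inner flip is moved past [r], is the action of [r * tflip r]. *)
Lemma mueger_centre_nilexp (r n : tens A A) V :
  r * tflip r = 1 ->
  (forall W (x : tens V W), tact n x = 0) ->
  (forall W (x : tens W V), tact n x = 0) ->
  mueger_centre (r * nilexp n) V.
Proof.
move=> r1 nl nr W x; rewrite /braiding !tactM !tact_nilexp //.
have -> : tflip (tact r x) = tact (tflip r) (tflip x) by rewrite tact_flip tflipK.
by rewrite -tactM r1 tact1 tflipK.
Qed.

End TensorAction.

(** * Modules and intertwiners from matrix representations *)

Section MatrixModules.
Variables (F : fieldType) (A : falgType F).

Section MatMod.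
Variables (n : nat) (f : {lrmorphism A -> 'M[F]_n.+1}).

Let mact (a : A) : 'End('cV[F]_n.+1) := linfun (mulmx (f a)).

Lemma mact_linear : linear mact.
Proof.
move=> c a b; apply/lfunP => v; rewrite !lfunE /= lfunE /= !lfunE /=.
by rewrite linearP mulmxDl scalemxAl.
Qed.

Lemma mact1 : mact 1 = \1%VF.
Proof. by apply/lfunP => v; rewrite !lfunE /= rmorph1 mul1mx. Qed.

Lemma mactM a b : mact (a * b) = (mact a \o mact b)%VF.
Proof. by apply/lfunP => v; rewrite !lfunE /= !lfunE /= rmorphM mulmxA. Qed.

Definition matmod : fdmod A := FdMod mact_linear mact1 mactM.

Lemma matmodE a (v : 'cV[F]_n.+1) : act matmod a v = f a *m v.
Proof. by rewrite lfunE. Qed.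

End MatMod.

Section Intertwiner.
Variables (p q : nat) (f : {lrmorphism A -> 'M[F]_p.+1}).
Variables (g : {lrmorphism A -> 'M[F]_q.+1}) (N : 'M[F]_(p.+1, q.+1)).

(* The conjugate of the block diagonal representation diag(f, g) by the       *)
(* unipotent matrix with off-diagonal block N; it differs from the one for    *)
(* N = 0 exactly by the failure of N to intertwine g and f.                   *)
Definition shear_rep (a : A) : 'M[F]_(p.+1 + q.+1) :=
  block_mx (f a) (f a *m N - N *m g a) 0 (g a).

Lemma shear_rep_linear : linear shear_rep.
Proof.
move=> c a b; rewrite /shear_rep scale_block_mx add_block_mx.
rewrite !linearP /= scaler0 addr0; congr block_mx.
by rewrite mulmxDl -scalemxAl scalerDr addrACA.
Qed.

Lemma shear_rep1 : shear_rep 1 = 1%:M.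
Proof. by rewrite /shear_rep !rmorph1 mulmx1 mul1mx subrr -scalar_mx_block. Qed.

(** The corner is a derivation with respect to [f] and [g]: in the product the two terms
    [f a *m N *m g b] cancel. *)
Lemma shear_repM a b : shear_rep (a * b) = shear_rep a *m shear_rep b.
Proof.
rewrite /shear_rep mulmx_block !rmorphM.
rewrite !mul0mx !mulmx0 !addr0 add0r; congr block_mx.
by rewrite mulmxBr mulmxBl !mulmxA addrA subrK.
Qed.

Lemma shear_rep_monoid_morphism :
  monoid_morphism (shear_rep : A -> 'M[F]_((p + q.+1).+1)).
Proof. by split; [exact: shear_rep1 | exact: shear_repM]. Qed.

HB.instance Definition _ := GRing.isLinear.Build F A 'M[F]_((p + q.+1).+1) _
  shear_rep shear_rep_linear.
HB.instance Definition _ := GRing.isMonoidMorphism.Build A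
  'M[F]_((p + q.+1).+1) shear_rep shear_rep_monoid_morphism.

End Intertwiner.
End MatrixModules.

(** * Roots of unity *)

Section RootsOfUnity.
Variable R : realType.

(** De Moivre's formula, from the addition formulas for [cos] and [sin]. *)
Lemma xi_expn_complex n k :
  xi R n ^+ k = Complex (cos (2 * pi / n%:R *+ k)) (sin (2 * pi / n%:R *+ k)).
Proof.
elim: k => [|k IH]; first by rewrite expr0 mulr0n cos0 sin0.
rewrite exprS IH ![_ *+ k.+1]mulrS cosD sinD /xi.
by congr Complex; rewrite addrC.
Qed.

Lemma xi_exprn n : (0 < n)%N -> xi R n ^+ n = 1.
Proof.
move=> n0; rewrite xi_expn_complex -mulr_natr divfK ?pnatr_eq0 -?lt0n //.
by rewrite mulr_natl cos2pi sin2pi.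
Qed.

End RootsOfUnity.

(** * Small representations of the Nenciu algebra and failure of semisimplicity *)

Section Nenciu.
Variables (R : realType) (s : nat) (m : 'I_s -> nat).
Local Notation C := R[i].

Section Intertwine.
Variables (t : nat) (d u : 'M[int]_(t, s)) (H : falgType C) (hH : hopfStruct H).
Variables (K : 'I_s -> H) (X : 'I_t -> H).
Hypothesis nH : is_nenciu m d u hH K X.

(** The presentation gives uniqueness of algebra maps rather than induction on words. Hence the
    intertwining property is read off from two algebra maps, the shears by [N] and by [0], which
    agree on generators. *)
Lemma nenciu_intertwine p q (f : {lrmorphism H -> 'M[C]_p.+1})
    (g : {lrmorphism H -> 'M[C]_q.+1}) (N : 'M[C]_(p.+1, q.+1)) :
  (forall a, f (K a) *m N = N *m g (K a)) ->
  (forall k, f (X k) *m N = N *m g (X k)) ->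
  forall x, f x *m N = N *m g x.
Proof.
move=> fgK fgX x; apply/eqP; rewrite -subr_eq0; apply/eqP.
have eq_shear y : f y *m N = N *m g y -> shear_rep f g N y = shear_rep f g 0 y.
  by rewrite /shear_rep => ->; rewrite mulmx0 mul0mx !subrr.
have : shear_rep f g N x = shear_rep f g 0 x.
  by apply: (nenciu_uniq nH (f := shear_rep f g N) (g := shear_rep f g 0)) x
    => [a|k]; apply: eq_shear.
by rewrite /shear_rep mulmx0 mul0mx subrr => /eq_block_mx[_ ->].
Qed.

Variable i : 'I_t.
Hypothesis m_gt0 : forall a, (0 < m a)%N.
Let c a : C := xi R (m a) ^ d i a.

Lemma weight_exp a : c a ^+ m a = 1.
Proof. by rewrite exprnP exprzAC -exprnP xi_exprn // exp1rz. Qed.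

Lemma nenciu_rep1 : exists f : {lrmorphism H -> 'M[C]_1},
  (forall a, f (K a) = (c a)%:M) /\ (forall k, f (X k) = 0).
Proof.
apply: (nenciu_ex nH); split=> [a|a b|a k|k|k l].
- by rewrite -rmorphXn weight_exp.
- by rewrite -[LHS]/(_ *m _) scalar_mxC.
- by rewrite mulr0 mul0r scaler0.
- by rewrite expr0n.
- by rewrite mulr0 scaler0.
Qed.

(** The weights 1 and [c a] are chosen so that [delta_mx 1 0] picks up exactly the scalar of the
    relation between [K a] and [X i]. Products of two nilpotent generators all vanish, whatever the
    scalars in their relations. *)
Lemma nenciu_rep2 : exists f : {lrmorphism H -> 'M[C]_2},
  (forall a, f (K a) = diag_mx (\row_j c a ^+ j)) /\
  (forall k, f (X k) = if k == i then delta_mx 1 0 else 0).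
Proof.
have dd : delta_mx 1 0 * delta_mx 1 0 = 0 :> 'M[C]_2.
  by rewrite -[LHS]/(_ *m _) mul_delta_mx_cond mulr0n.
apply: (nenciu_ex nH); split=> [a|a b|a k|k|k l].
- have -> n : diag_mx (\row_j c a ^+ j) ^+ n = diag_mx (\row_j (c a ^+ n) ^+ j)
      :> 'M[C]_2.
    elim: n => [|n IH].
      by apply/matrixP=> j l; rewrite expr0 !mxE expr1n.
    rewrite exprS IH -[LHS]/(_ *m _) mulmx_diag; congr diag_mx.
    by apply/rowP=> j; rewrite !mxE -exprMn exprS.
  by apply/matrixP=> j l; rewrite weight_exp !mxE expr1n.
- by rewrite -[LHS]/(_ *m _) diag_mxC.
- case: eqP => [->|_]; last by rewrite mulr0 mul0r scaler0.
  rewrite -[X in X = _]/(_ *m _) -[X in _ = _ *: X]/(_ *m _).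
  rewrite mul_diag_mx mul_mx_diag; apply/matrixP=> j l; rewrite !mxE.
  have [->|] := eqVneq j 1; have [->|] := eqVneq l 0; rewrite ?mul0r ?mulr0 //.
  by rewrite expr1 expr0 !mulr1.
- by rewrite expr2; case: eqP => _; rewrite ?mulr0.
- by do 2!case: eqP => _; rewrite ?dd ?mulr0 ?mul0r scaler0.
Qed.

(* The module of nenciu_rep2 is a nonsplit extension, and its submodule       *)
(* nenciu_rep1 keeps it from being simple.                                    *)
Lemma nenciu_not_semisimple (Cat : fullsubcat H) :
  (forall V : fdmod H,
     (forall k, k != i -> forall v : V, act V (X k) v = 0) -> Cat V) ->
  ~ semisimple_subcat Cat.
Proof.
move=> CatP ss.
have [f [fK fX]] := nenciu_rep2; have [g [gK gX]] := nenciu_rep1.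
pose V := matmod f; pose T := matmod g.
pose N : 'M[C]_(2, 1) := delta_mx 1 0.
have CV : Cat V.
  by apply: CatP => k /negbTE ki v; rewrite matmodE fX ki mul0mx.
have CT : Cat T by apply: CatP => k _ v; rewrite matmodE gX mul0mx.
(* [N] embeds the line [T] into [V] as the image of [X i]. *)
have fgN x : f x *m N = N *m g x.
  apply: nenciu_intertwine x => [a|k].
    rewrite fK gK mul_diag_mx mul_mx_scalar; apply/matrixP=> j l.
    by rewrite !mxE; have [->|] := eqVneq j 1; rewrite ?mulr0.
  rewrite fX gX mulmx0; case: eqP => _; last by rewrite mul0mx.
  by rewrite mul_delta_mx_cond mulr0n.
have [n [S [j [simS jP _ sumS]]]] := ss V CV.
(* The summands span [V], and [X i] sends the first basis vector to the second, so it cannot kill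
   all of them. *)
have [k kP] : exists k, ~~ (limg (j k) <= lker (act V (X i)))%VS.
  apply/existsP; rewrite -negb_forall; apply/negP => /forallP all_ker.
  have: (fullv <= lker (act V (X i)))%VS by rewrite -sumS; apply/subv_sumP.
  move/subvP/(_ (delta_mx 0 0) (memvf _)); rewrite memv_ker matmodE fX eqxx.
  rewrite mul_delta_mx => /eqP/matrixP/(_ 1 0)/eqP.
  by rewrite !mxE oner_eq0.
have [modj jinj] := jP k; have [_ _ simk] := simS k.
have jK := lker0_lfunK (introT eqP jinj).
have /subvPn [_ /memv_imgP [w _ ->]] := kP.
rewrite memv_ker matmodE fX eqxx => wN.
(* Applying [X i] to [j k w] moves its nonzero first coordinate to the second place; rescaling
   reaches every vector of the line. *)
have Nimg v : N *m v \in limg (j k).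
  have -> : N *m v = (v 0 0 / (j k w) 0 0) *: j k (act (S k) (X i) w).
    have w00 : (j k w) 0 0 != 0.
      apply: contraNneq wN => w0; apply/eqP/matrixP=> a b.
      rewrite !mxE big_ord_recl big_ord1 [b]ord1 w0 !mxE.
      by rewrite mulr0 andbF mul0r addr0.
    rewrite modj matmodE fX eqxx; apply/matrixP=> a b.
    rewrite !mxE big_ord1 big_ord_recl big_ord1 [b]ord1 !mxE /=.
    rewrite andbF andbT mul0r addr0.
    have cancel_w (p q r : C) : r != 0 -> q * p = p / r * (q * r).
      by move=> r0; rewrite mulrCA divfK.
    exact: cancel_w.
  by rewrite memvZ ?memv_img ?memvf.
(* The embedding [N] lands in the image of the injective [j k], so it factors through [S k]. *)
pose h : 'Hom(T, S k) := ((j k)^-1 \o linfun (mulmx N))%VF.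
have jh v : j k (h v) = N *m v by rewrite lfunE /= limg_lfunVK lfunE /= ?Nimg.
have modh : modhom h.
  move=> x v; apply: (can_inj jK).
  by rewrite modj !jh !matmodE mulmxA -fgN -mulmxA.
have hinj : lker h = 0%VS.
  apply/eqP; rewrite -subv0; apply/subvP => v; rewrite memv_ker memv0.
  move/eqP/(congr1 (j k)); rewrite jh linear0 => /matrixP/(_ 1 0).
  rewrite !mxE big_ord1 mxE mul1r => v0.
  by apply/eqP/matrixP=> a b; rewrite !ord1 v0 mxE.
(* The image of [h] is nonzero because [N] is, and it misses [w] because [X i] kills the line but
   not [j k w]. *)
case: (simk T h CT modh hinj) => himg.
  have := memv_img h (memvf (1 : 'M[C]_1)); rewrite himg memv0.
  move/eqP/(congr1 (j k)); rewrite jh mulmx1 linear0 => /matrixP/(_ 1 0)/eqP.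
  by rewrite !mxE oner_eq0.
have /memv_imgP [v _ wv] : w \in limg h by rewrite himg memvf.
have := fgN (X i); rewrite fX eqxx gX mulmx0 => N0.
by move: wN; rewrite wv jh mulmxA N0 mul0mx eqxx.
Qed.
End Intertwine.

(** Each term of the exponent has some [Z] in both tensor factors, so it vanishes on whichever side
    [V] stands. *)
Lemma mueger_centre_Ralpha t1 t2 (u : 'M[int]_(t1 + (t2 + t2), s))
    (z : 'M[int]_s) (alpha : 'I_t2 -> C) (H : falgType C) (K : 'I_s -> H)
    (X : 'I_(t1 + (t2 + t2)) -> H) (V : fdmod H) :
  Rz m z K * tflip (Rz m z K) = 1 ->
  (forall l, alpha l != 0 -> forall v : V,
     act V (X (idxZp t1 l)) v = 0 /\ act V (X (idxZm t1 l)) v = 0) ->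
  mueger_centre (Rz m z K * Ralpha alpha u K X) V.
Proof.
move=> Rz1 VZ; apply: mueger_centre_nilexp => // W x;
  rewrite /tact linear_sum big1 // => l _; rewrite linearZ /=;
  have [->|/VZ Vl] := eqVneq (alpha l) 0; rewrite ?scale0r //;
  rewrite linearB /= -![textend _ _]/(tact _ _) !tact_eq0 ?subrr ?scaler0 //.
- by left=> v; case: (Vl v).
- by left=> v; case: (Vl v).
- by right=> v; rewrite actM lfunE /=; case: (Vl v) => -> _; rewrite linear0.
- by right=> v; rewrite actM lfunE /=; case: (Vl v) => _ ->; rewrite linear0.
Qed.

End Nenciu.

Theorem proposition5p39 (R : realType) (s t1 t2 : nat) (m : 'I_s -> nat)
    (d u : 'M[int]_(t1 + (t2 + t2), s)) (z : 'M[int]_s)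
    (alpha : 'I_t2 -> R[i])
    (H : falgType R[i]) (hH : hopfStruct H)
    (K : 'I_s -> H) (X : 'I_(t1 + (t2 + t2)) -> H) :
  nenciu_datum R m d u ->
  is_nenciu m d u hH K X ->
  opposite_type m d u ->
  Z_anticommute X ->
  Rz m z K * tflip (Rz m z K) = 1 ->
  is_Rmatrix hH (Rz m z K * Ralpha alpha u K X) ->
  (0 < t1)%N \/ (exists l, alpha l = 0) ->
  ~ semisimple_subcat (mueger_centre (Rz m z K * Ralpha alpha u K X)).
Proof.
move=> [_ _ m_gt0 _ _] nH _ _ Rz1 _ degenerate.
have [i iP] : exists i, forall l, alpha l != 0 ->
    idxZp t1 l != i /\ idxZm t1 l != i.
  case: degenerate => [t1_gt0|[l0 al0]].
    by exists (idxX t2 (Ordinal t1_gt0)) => l _; rewrite !eq_rlshift.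
  (* An index [l] with nonzero [alpha l] differs from [l0], and plus and minus generators occupy
     disjoint blocks of indices. *)
  exists (idxZp t1 l0) => l al; rewrite !eq_rshift eq_lshift eq_rlshift.
  by split=> //; apply: contraNneq al => ->; rewrite al0.
apply: (nenciu_not_semisimple nH (i := i)) => // V VX.
by apply: mueger_centre_Ralpha => // l /iP[Zp Zm] v; rewrite !VX.
Qed.
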